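(* In the first Heisenberg group $\mathbb{H}^1=\mathbb{R}^3$, define \[\Upsilon:=\{(x,y,t)\in\mathbb{H}^1: |t|\ge 2|(x,y)|^2\}\] and \[P_c:=\Upsilon\cap\Big(\{0\}\cup\bigcup_{n=1}^{\infty}\bigcup_{k=0}^{2^n-1}\{(x,y,t)\in\mathbb{H}^1: |(x,y)|\in A_{n,k}\}\Big),\] where $A_{n,k}:=(2^{-n}+k2^{-2n})+2^{-2n}C$, $C\subset[0,1]$ is the middle third Cantor set, and $|(x,y)|$ is the Euclidean norm on $\mathbb{R}^2$. Then $P_c$ is porous with respect to the Carnot–Carathéodory distance on $\mathbb{H}^1$, but $P_c$ is not porous at the point $0$ with respect to the Euclidean distance on $\mathbb{R}^3$.
   Context: For $\alpha,\beta\in\mathbb{R}$ and $S\subset\mathbb{R}$, $\alpha+\beta S=\{\alpha+\beta s:s\in S\}$. The first Heisenberg group $\mathbb{H}^1$ is $\mathbb{R}^3$ with the group law $(x,y,t)(x',y',t')=(x+x',\,y+y',\,t+t'-2(xy'-yx'))$. It is a Carnot group of step 2 with horizontal layer $V_1$ spanned by the left-invariant vector fields $X=\partial_x+2y\,\partial_t$ and $Y=\partial_y-2x\,\partial_t$. An absolutely continuous curve $\gamma:[a,b]\to\mathbb{H}^1$ is horizontal if $\gamma'(s)=u_1(s)X(\gamma(s))+u_2(s)Y(\gamma(s))$ for a.e. $s$ with $u_1,u_2\in L^1[a,b]$; its length is $\int_a^b|(u_1(s),u_2(s))|\,ds$. The Carnot–Carathéodory (CC) distance between two points is the infimum of lengths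 of horizontal curves joining them. Porosity: let $(M,d)$ be a metric space, $E\subset M$, $B(x,r)$ the open ball. For $\lambda\in(0,1)$ and $a\in E$, $E$ is $\lambda$-porous at $a$ if there is a sequence of points $x_j\in M\setminus\{a\}$ with $x_j\to a$ and $B(x_j,\lambda d(x_j,a))\cap E=\varnothing$ for every $j$. $E$ is porous at $a$ if it is $\lambda$-porous at $a$ for some $\lambda\in(0,1)$. $E$ is porous if there is $\lambda\in(0,1)$ (independent of the point) such that $E$ is $\lambda$-porous at every $a\in E$. *)

(* Defs.v *)
From HB Require Import structures.
From mathcomp Require Import all_boot all_order all_algebra.
From mathcomp Require Import ring.
From mathcomp Require Import all_classical all_reals all_analysis.

Set Implicit Arguments.
Unset Strict Implicit.
Unset Printing Implicit Defensive.

Import Order.TTheory GRing.Theory Num.Theory.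
Import numFieldNormedType.Exports.

Local Open Scope classical_set_scope.
Local Open Scope ring_scope.

Section porosity.
Context {R : realType} {M : Type}.
Variable d : M -> M -> R.
Implicit Types (E : set M) (a x : M) (l r : R).

Definition dball x r : set M := [set y | d x y < r].

Definition porous_with E l a : Prop :=
  exists x_ : nat -> M,
    [/\ forall j, x_ j <> a,
        d (x_ j) a @[j --> \oo] --> (0 : R)
      & forall j, dball (x_ j) (l * d (x_ j) a) `&` E = set0].

Definition porous_at E a : Prop := exists2 l : R, 0 < l < 1 & porous_with E l a.

Definition porous E : Prop :=
  exists2 l : R, 0 < l < 1 & forall a, E a -> porous_with E l a.

End porosity.

(* Points are triples (x, y, t), parsed as ((x, y), t). *)
Notation heis R := (R * R * R)%type.

Section heisenberg.
Context {R : realType}.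
Implicit Types (p q : heis R) (a b : R) (gamma : R -> heis R).

Definition eucl_norm2 (z : R * R) : R := Num.sqrt (z.1 ^+ 2 + z.2 ^+ 2).

Definition eucl_dist p q : R :=
  Num.sqrt ((p.1.1 - q.1.1) ^+ 2 + (p.1.2 - q.1.2) ^+ 2 + (p.2 - q.2) ^+ 2).

Definition heis_mul p q : heis R :=
  (p.1.1 + q.1.1, p.1.2 + q.1.2,
   p.2 + q.2 - 2 * (p.1.1 * q.1.2 - p.1.2 * q.1.1)).

Definition fieldX p : heis R := (1, 0, 2 * p.1.2).
Definition fieldY p : heis R := (0, 1, - (2 * p.1.1)).

(* X and Y are the left-invariant fields with values (1, 0, 0) and (0, 1, 0)
   at the identity. *)
Lemma heis_mulX p (s : R) : heis_mul p (s, 0, 0) = p + s *: fieldX p.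
Proof.
by case: p => [[x y] t]; rewrite /heis_mul /fieldX /=; congr (_, _, _) => /=;
  rewrite /GRing.scale /=; ring.
Qed.

Lemma heis_mulY p (s : R) : heis_mul p (0, s, 0) = p + s *: fieldY p.
Proof.
by case: p => [[x y] t]; rewrite /heis_mul /fieldY /=; congr (_, _, _) => /=;
  rewrite /GRing.scale /=; ring.
Qed.

Definition abs_continuous a b gamma : Prop :=
  forall e : R, 0 < e -> exists2 dlt : R, 0 < dlt &
    forall (n : nat) (B : 'I_n -> R * R),
      (forall i, [/\ a <= (B i).1, (B i).1 <= (B i).2 & (B i).2 <= b]) ->
      trivIset setT (fun i => `](B i).1, (B i).2[%classic) ->
      \sum_(i < n) ((B i).2 - (B i).1) < dlt ->
      \sum_(i < n) eucl_dist (gamma (B i).2) (gamma (B i).1) < e.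

Local Notation mu := (@lebesgue_measure R).

(* The curve is the restriction of gamma to [a, b]: values outside [a, b] are
   irrelevant, since only derivatives at points of the open interval occur. *)
Definition horizontal a b gamma (u1 u2 : R -> R) : Prop :=
  [/\ abs_continuous a b gamma,
      mu.-integrable `[a, b] (EFin \o u1),
      mu.-integrable `[a, b] (EFin \o u2)
    & {ae mu, forall s, a < s < b ->
        is_derive s 1 gamma
          (u1 s *: fieldX (gamma s) + u2 s *: fieldY (gamma s))}].

Definition horizontal_length a b (u1 u2 : R -> R) : R :=
  \int[mu]_(s in `[a, b]) eucl_norm2 (u1 s, u2 s).

(* Any two points are joined by a horizontal curve, so the infimum below is
   over a nonempty set of nonnegative reals. *)
Definition cc_dist p q : R :=
  inf [set L | exists a b gamma (u1 u2 : R -> R),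
    [/\ a < b, gamma a = p, gamma b = q, horizontal a b gamma u1 u2
      & L = horizontal_length a b u1 u2]].

End heisenberg.

Section the_set.
Context {R : realType}.

Definition affine_image (alpha beta : R) (S : set R) : set R :=
  [set alpha + beta * s | s in S].

Fixpoint cantor_stage (m : nat) : set R :=
  if m is m'.+1 then
    affine_image 0 3^-1 (cantor_stage m') `|`
    affine_image (2 / 3) 3^-1 (cantor_stage m')
  else `[0, 1].

Definition middle_third_cantor : set R := \bigcap_m cantor_stage m.

Definition A_ (n k : nat) : set R :=
  affine_image (2 ^- n + k%:R * 2 ^- (2 * n)) (2 ^- (2 * n)) middle_third_cantor.

Definition Upsilon : set (heis R) :=
  [set p | 2 * eucl_norm2 p.1 ^+ 2 <= `|p.2| ].

Definition Pc : set (heis R) :=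
  Upsilon `&`
    ([set 0] `|`
     \bigcup_(n in [set n : nat | (1 <= n)%N])
       \bigcup_(k in [set k : nat | (k <= 2 ^ n - 1)%N])
         [set p : heis R | A_ n k (eucl_norm2 p.1)]).

End the_set.

(* Main.v *)
Require Import Defs.
From mathcomp Require Import all_boot all_order all_algebra.
From mathcomp Require Import all_classical all_reals all_analysis.
From mathcomp Require Import measurable_realfun ring lra.
Set Implicit Arguments.
Unset Strict Implicit.
Unset Printing Implicit Defensive.
Import Order.TTheory GRing.Theory Num.Theory.
Import numFieldNormedType.Exports.
Local Open Scope classical_set_scope.
Local Open Scope ring_scope.

(** Why the set is porous for the Carnot-Caratheodory distance.

    Write rho(p) = |(x, y)| for the radius of p = (x, y, t).  Radial segments
    with constant t are horizontal, since the area term 2 (y x' - x y')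
    vanishes along them; hence moving a point radially costs exactly the change
    of radius ([cc_dist_radial]), while no curve can change the radius by more
    than its length ([cc_dist_lt]).  At a point of the set other than the
    origin, porosity is therefore porosity of the set of admissible radii, a
    union of rescaled Cantor sets in consecutive intervals, and the removed
    thirds provide the holes ([cantor_gap], [radii_gap]).  At the origin the
    relative size 2^-n of the Cantor sets tends to 0, so their holes are
    useless there.  The cone Upsilon helps instead: a curve of length L
    starting at radius s changes t by at most 2 (s + L) L, so that the ball of
    radius s / 6 around (s, 0, 0) stays in the region |t| < 2 rho^2.

    Why it is not porous at the origin for the Euclidean distance.  At scale r
    the complement of Upsilon has thickness of order r^2 only, and so have the
    gaps between admissible radii of order r, because the interval from 2^-n to
    2^(1-n) is cut into 2^n pieces of length 4^-n ([radius_below]).  So every point at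
    distance D from the origin has a point of the set within a distance that is
    o(D) ([Pc_dense_near_origin]).

    Since the distance is an infimum of lengths of absolutely continuous curves
    whose derivative is prescribed almost everywhere, two facts support the
    estimates above.  The lower bounds need that such a curve is controlled by
    the integral of its speed ([ac_increment_le_integral]).  They also need
    that any two points are joined by some horizontal curve, because the
    infimum of the empty set is 0; explicit polynomial curves do this
    ([joining_curve]). *)

(** * Increments of absolutely continuous functions *)

Section real_induction.
Context {R : realType}.
Implicit Types (a b c x y z r : R).

(** Real induction in the form of a two-sided gauge: a property that crosses
    every point of [a, b] along short intervals around it holds at b as soon
    as it holds at a.  This replaces the choice of a finite tagged partition
    subordinate to a gauge. *)
Lemma real_induction a b (P : R -> Prop) : a <= b -> P a ->
  (forall c, a <= c <= b -> exists2 r, 0 < r & forall z y,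
     a <= z -> z <= c -> c <= y -> y <= b -> c - r < z -> y < c + r ->
     P z -> P y) ->
  P b.
Proof.
move=> ab Pa step.
pose E := [set x | [/\ a <= x, x <= b & P x]].
have Ea : E a by split.
have supE : has_sup E.
  by split; [exists a|exists b => x []].
have aE : a <= sup E by apply: ub_le_sup => //; case: supE.
have Eb : sup E <= b by apply: ge_sup => [|x []]; first by exists a.
have [|r r0 rP] := step (sup E); first by rewrite aE.
have [z [az zb Pz] Ez] := sup_adherent r0 supE.
have zE : z <= sup E by apply: ub_le_sup => //; case: supE.
(* One step beyond the supremum, cut off at b: this forces sup E = b. *)
pose y := Num.min b (sup E + r / 2).
have Py : P y.
  apply: (rP z) => //; rewrite /y;
    first by rewrite le_min Eb lerDl divr_ge0 ?ltW.
  - by rewrite ge_min lexx.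
  - by rewrite gt_min; apply/orP; right;
      rewrite ltrD2l gtr_pMr// invf_lt1 ?ltr1n.
have yE : y <= sup E.
  apply: ub_le_sup; first by case: supE.
  split=> //; last by rewrite /y ge_min lexx.
  by rewrite /y le_min ab/= (le_trans aE)// lerDl divr_ge0 ?ltW.
move: yE Py; rewrite /y minEle; case: ifP => // _.
by rewrite gerDl leNgt divr_gt0.
Qed.

Lemma is_derive_near (V : normedModType R) (f : R -> V) x (v : V) (e : R) :
  0 < e -> is_derive x 1 f v ->
  exists2 r, 0 < r & forall y, `|y - x| < r ->
    `|f y - f x - (y - x) *: v| <= e * `|y - x|.
Proof.
move=> e0 [df <-].
move: df; rewrite /derivable => /cvg_ex[/= l fl].
have -> : 'D_1 f x = l by apply: cvg_lim => //; exact: norm_hausdorff.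
move/cvgrPdist_le : fl => /(_ _ e0); rewrite near_withinE => -[r /= r0 rP].
exists r => // y yx.
have [->|yx0] := eqVneq y x.
  by rewrite !(subrr, scale0r, subr0, normr0) mulr0.
have := rP (y - x); rewrite /= sub0r normrN subr_eq0 => /(_ yx yx0).
have d0 : y - x != 0 by rewrite subr_eq0.
rewrite (_ : (y - x) *: 1 + x = y); last by rewrite /GRing.scale/= mulr1 subrK.
move=> H.
rewrite -[f y - f x](scalerKV d0) -scalerBr normrZ mulrC ler_wpM2r//.
by rewrite distrC.
Qed.

End real_induction.

Section abs_continuous_real.
Context {R : realType}.
Notation mu := (@lebesgue_measure R).
Implicit Types (a b c x y z r e : R) (f g : R -> R).

Definition abs_continuousR a b f : Prop :=
  forall e, 0 < e -> exists2 dlt : R, 0 < dlt &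
    forall (n : nat) (B : 'I_n -> R * R),
      (forall i, [/\ a <= (B i).1, (B i).1 <= (B i).2 & (B i).2 <= b]) ->
      trivIset setT (fun i => `](B i).1, (B i).2[%classic) ->
      \sum_(i < n) ((B i).2 - (B i).1) < dlt ->
      \sum_(i < n) `|f (B i).2 - f (B i).1| < e.

(** A list of intervals, each lying to the left of its predecessor, is what an
    induction from left to right builds; indexing by ordinals only serves to
    match the definition. *)
Lemma abs_continuousR_seq a b f e : abs_continuousR a b f -> 0 < e ->
  exists2 dlt : R, 0 < dlt & forall s : seq (R * R),
    (forall p, p \in s -> [/\ a <= p.1, p.1 <= p.2 & p.2 <= b]) ->
    pairwise (fun p q : R * R => q.2 <= p.1) s ->
    \sum_(p <- s) (p.2 - p.1) < dlt ->
    \sum_(p <- s) (f p.2 - f p.1) < e.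
Proof.
move=> acf e0; have [d d0 dP] := acf _ e0; exists d => // s sab spw ssum.
have := dP (size s) (tnth (in_tuple s)).
rewrite -!(big_tnth _ _ s xpredT (fun p => p.2 - p.1)).
move=> H; apply: le_lt_trans (H _ _ _) => //.
- rewrite [leLHS]big_tnth; apply: ler_sum => i _; exact: ler_norm.
- by move=> i; apply: sab; exact: mem_tnth.
have tri (i j : 'I_(size s)) t : (i < j)%N ->
    t < (tnth (in_tuple s) j).2 -> (tnth (in_tuple s) i).1 < t -> False.
  move=> ij tj ti.
  have := pairwiseP (0, 0) spw i j (ltn_ord i) (ltn_ord j) ij.
  rewrite -!(tnth_nth _ (in_tuple s)) => ji.
  by move: (lt_le_trans (lt_trans ti tj) ji); rewrite ltxx.
move=> i j _ _ [t [/=]]; rewrite !in_itv/= => /andP[it ti] /andP[jt tj].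
apply/val_inj; case: (ltngtP i j) => // ij; exfalso.
- exact: (tri i j t).
- exact: (tri j i t).
Qed.

Lemma negligible_open_cover (N : set R) e : mu.-negligible N -> 0 < e ->
  exists U : set R, [/\ open U, N `<=` U & (mu U < e%:E)%E].
Proof.
move=> [A [mA A0 NA]] e0.
have [|U [oU AU UA]] := lebesgue_regularity_outer mA _ e0.
  by rewrite [X in (X < _)%E]A0 ltry.
exists U; split => //; first exact: subset_trans AU.
have mU : measurable U by exact: open_measurable.
rewrite -(setDUK AU) measureU//; last 2 first.
- exact: measurableD.
- by apply/seteqP; split => t //= -[? []].
by rewrite [X in (X + _)%E]A0 add0e.
Qed.

(** Let F be a primitive of g, nondecreasing because g is nonnegative.  By the
    Lebesgue differentiation theorem, outside a null set N both f and F are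
    differentiable and f' <= F', so that f increases at most as much as F, up
    to e1 times the length, on short intervals around a point outside N.
    Around a point of N, take a short interval inside an open set U of small
    measure containing N: nothing bounds f there, so the interval is recorded.
    Real induction chains these steps from a to b, and the recorded intervals
    have total length less than the measure of U, hence by absolute continuity
    they contribute a negligible increment of f. *)
Lemma ac_increment_le_integral a b f g (v : R -> R) :
  a < b -> abs_continuousR a b f ->
  mu.-integrable `[a, b] (EFin \o g) -> (forall x, 0 <= g x) ->
  {ae mu, forall x, a < x < b -> is_derive x 1 f (v x) /\ v x <= g x} ->
  f b - f a <= \int[mu]_(x in `[a, b]) g x.
Proof.
move=> ab acf ig g0 aef.
pose g' := g \_ `[a, b].
have ig' : mu.-integrable setT (EFin \o g').
  by rewrite /g' -restrict_EFin;
    apply/integrable_restrict => //=; rewrite setTI.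
have g'0 x : 0 <= g' x by rewrite /g' patchE; case: ifP.
pose F x := \int[mu]_(t in `]-oo, x]) g' t.
have ig'S (A : set R) : measurable A -> mu.-integrable A (EFin \o g').
  by move=> mA; exact: integrableS ig'.
have FB x y : x <= y -> F y - F x = \int[mu]_(t in `]x, y]) g' t.
  by move=> xy; rewrite /F Rintegral_itvB//; exact: ig'S.
have Fmono x y : x <= y -> F x <= F y.
  by move=> xy; rewrite -subr_ge0 FB//; exact: Rintegral_ge0.
have Fab : F b - F a = \int[mu]_(x in `[a, b]) g x.
  rewrite FB ?ltW// Rintegral_itv_obnd_cbnd; last exact: ig'S.
  by apply: eq_Rintegral => x xab; rewrite /g' patchE xab.
have aeF : {ae mu, forall x, derivable F x 1 /\ derive1 F x = g' x}.
  apply: FTC1Ny; first by move=> y; exact: ig'S.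
  exact: integrable_locally.
rewrite -Fab -subr_le0; apply/ler_addgt0Pl => e e0; rewrite addr0.
pose e1 := e / 3 / (b - a).
have ba0 : 0 < b - a by rewrite subr_gt0.
have e10 : 0 < e1 by rewrite !divr_gt0.
have e30 : 0 < e / 3 by rewrite divr_gt0.
have [d d0 dP] := abs_continuousR_seq acf e30.
pose good x := [/\ is_derive x 1 f (v x), v x <= g' x & is_derive x 1 F (g' x)].
(* The endpoints are exceptional too, as f' is known only inside (a, b). *)
pose N := [set x | x = a \/ x = b \/ (a < x < b /\ ~ good x)].
have N0 : mu.-negligible N.
  have : mu.-negligible ([set a] `|` [set b] `|` ~` [set x | a < x < b -> good x]).
    apply: negligibleU; first by apply: negligibleU;
      apply/negligibleP => //; exact: lebesgue_measure_set1.
    have : {ae mu, forall x, a < x < b -> good x}.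
      apply: filterS2 aef aeF; first exact: (ae_filter_ringOfSetsType mu).
      move=> x + [dF F'] xab => /(_ xab)[df vg].
      have xab' : x \in `[a, b].
        by case/andP: xab => ax xb; rewrite in_itv/= !ltW.
      split => //; first by rewrite /g' patchE mem_set.
      by rewrite -F' derive1E; exact: derivableP.
    by [].
  apply: negligibleS => x [->|[->|[xab ngx]]]; [by left; left|by left; right|].
  by right => /= /(_ xab).
have [U [oU NU Ud]] := negligible_open_cover N0 d0.
have mU : measurable U by exact: open_measurable.
have Ufin A : measurable A -> mu (U `&` A) \is a fin_num.
  move=> mA; rewrite ge0_fin_numE//.
  apply: le_lt_trans (lt_trans Ud (ltry _)); apply: le_measure => //; rewrite ?inE//.
  exact: measurableI.
pose m x := fine (mu (U `&` `[a, x])).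
have mD z y : a <= z -> z <= y -> `[z, y] `<=` U -> m z + (y - z) <= m y.
  move=> az zy zyU.
  have -> : y - z = fine (mu `]z, y]).
    rewrite lebesgue_measure_itv/= lte_fin; move: zy; rewrite le_eqVlt.
    by case/predU1P => [->|->]//; rewrite ltxx subrr.
  have mUz : measurable (U `&` `[a, z]) by exact: measurableI.
  have fzy : mu `]z, y] \is a fin_num.
    by rewrite lebesgue_measure_itv/=; case: ifP.
  rewrite /m -fineD ?Ufin// -measureU//; last first.
    apply/disj_set2P/disj_setPS => t [[_ /=]]; rewrite !in_itv/= => /andP[_ tz].
    by rewrite ltNge tz.
  rewrite fine_le ?Ufin//.
    rewrite measureU//; first by rewrite fin_numD Ufin.
    apply/disj_set2P/disj_setPS => t [[_ /=]]; rewrite !in_itv/= => /andP[_ tz].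
    by rewrite ltNge tz.
  apply: le_measure; rewrite ?inE//; [exact: measurableU|exact: measurableI|].
  move=> t [[Ut /=]|/=]; rewrite !in_itv/= => /andP[at' tz].
    by split => //; rewrite at' (le_trans tz).
  split; first by apply: zyU; rewrite /= in_itv/= tz ltW.
  by rewrite tz (le_trans az)// ltW.
(* The intervals of s are the recorded ones; the bound by m x on their total
   length avoids measuring their union. *)
pose P x := exists s : seq (R * R),
  [/\ forall p, p \in s -> [/\ a <= p.1, p.1 <= p.2 & p.2 <= x],
      pairwise (fun p q : R * R => q.2 <= p.1) s,
      \sum_(p <- s) (p.2 - p.1) <= m x &
      f x - f a <= F x - F a + e1 * (x - a) + \sum_(p <- s) (f p.2 - f p.1)].
suff [s [sab spw ssum Pb]] : P b.
  have {}ssum : \sum_(p <- s) (p.2 - p.1) < d.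
    apply: le_lt_trans ssum _; rewrite -lte_fin fineK; last exact: Ufin.
    apply: le_lt_trans Ud; apply: le_measure => //; rewrite ?inE//.
    exact: measurableI.
  have := dP _ sab spw ssum => fs.
  rewrite lerBlDl (le_trans Pb)// -addrA lerD2l.
  have -> : e1 * (b - a) = e / 3 by rewrite /e1 divfK// gt_eqF.
  lra.
apply: (real_induction (ltW ab)).
  exists [::]; split => //; rewrite !big_nil ?fine_ge0//.
  by rewrite !subrr mulr0 !addr0.
move=> c /andP[ac cb].
have [Nc|Nc] := pselect (N c).
  have /oU[r /= r0 rU] : U c by exact: NU.
  exists r => // z y az zc cy yb crz ycr [s [sax spw ssum Pz]].
  have zy : z <= y by exact: le_trans cy.
  exists ((z, y) :: s); split.
  - move=> p; rewrite inE => /orP[/eqP ->//|/sax[? ? pz]].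
    by split => //; exact: le_trans zy.
  - by rewrite /= spw andbT; apply/allP => q /sax[].
  - rewrite big_cons/=; apply: le_trans (mD z y az zy _).
      by rewrite addrC lerD2r.
    move=> t /=; rewrite in_itv/= => /andP[zt ty]; apply: rU => /=.
    by rewrite ltr_distlC (lt_le_trans crz zt) (le_lt_trans ty ycr).
  - rewrite big_cons/=; have := Fmono _ _ zy.
    have : e1 * (z - a) <= e1 * (y - a) by rewrite ler_wpM2l ?(ltW e10)// lerB.
    lra.
have cab : a < c < b.
  rewrite !lt_neqAle ac cb !andbT; apply/andP; split; apply/eqP => E; apply: Nc.
  - by left.
  - by right; left.
have [df vg dF] : good c.
  by apply: contrapT => ngc; apply: Nc; right; right.
have e120 : 0 < e1 / 2 by rewrite divr_gt0.
have [r1 r10 r1P] := is_derive_near e120 df.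
have [r2 r20 r2P] := is_derive_near e120 dF.
exists (Num.min r1 r2); first by rewrite lt_min r10.
move=> z y az zc cy yb crz ycr [s [sax spw ssum Pz]].
have zy : z <= y by exact: le_trans cy.
have [zr1 zr2] : `|z - c| < r1 /\ `|z - c| < r2.
  by apply/andP; rewrite -lt_min distrC ger0_norm ?subr_ge0// ltrBlDr -ltrBlDl.
have [yr1 yr2] : `|y - c| < r1 /\ `|y - c| < r2.
  by apply/andP; rewrite -lt_min ger0_norm ?subr_ge0// ltrBlDl.
exists s; split => //.
- by move=> p /sax[? ? ?]; split => //; exact: le_trans zy.
- apply: le_trans ssum _; rewrite fine_le// ?Ufin//.
  apply: le_measure; rewrite ?inE//; try exact: measurableI.
  by apply: setIS => t /=; rewrite !in_itv/= => /andP[-> /le_trans ->].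
- move: (r1P _ zr1) (r1P _ yr1) (r2P _ zr2) (r2P _ yr2).
  rewrite /GRing.scale/= (distrC z c) ![`|_ - c|]ger0_norm ?subr_ge0//.
  rewrite ![`|c - _|]ger0_norm ?subr_ge0// !ler_norml.
  move=> /andP[A1 A2] /andP[B1 B2] /andP[C1 C2] /andP[D1 D2].
  have : v c * (y - z) <= g' c * (y - z) by rewrite ler_wpM2r// subr_ge0.
  nra.
Qed.

End abs_continuous_real.

(** * Length bounds for horizontal curves *)

Section horizontal_curves.
Context {R : realType}.
Notation mu := (@lebesgue_measure R).
Implicit Types (a b c s x y z r e : R) (p q : heis R) (gamma : R -> heis R).

Lemma eucl_norm2_ge0 (z : R * R) : 0 <= eucl_norm2 z.
Proof. exact: sqrtr_ge0. Qed.

Lemma sqr_eucl_norm2 (z : R * R) : eucl_norm2 z ^+ 2 = z.1 ^+ 2 + z.2 ^+ 2.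
Proof. by rewrite sqr_sqrtr// addr_ge0// sqr_ge0. Qed.

Lemma cauchy_schwarz2 (v w : R * R) :
  v.1 * w.1 + v.2 * w.2 <= eucl_norm2 v * eucl_norm2 w.
Proof.
apply: le_trans (ler_norm _) _.
rewrite -(@ler_pXn2r _ 2)// ?nnegrE ?mulr_ge0 ?eucl_norm2_ge0//.
rewrite exprMn !sqr_eucl_norm2 real_normK ?num_real//.
rewrite -subr_ge0 (_ : _ - _ = (v.1 * w.2 - v.2 * w.1) ^+ 2) ?sqr_ge0//.
ring.
Qed.

Lemma eucl_norm2_le_add (z : R * R) : eucl_norm2 z <= `|z.1| + `|z.2|.
Proof.
rewrite -(@ler_pXn2r _ 2)// ?nnegrE ?addr_ge0 ?eucl_norm2_ge0//.
rewrite sqr_eucl_norm2 sqrrD !real_normK ?num_real//.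
by rewrite addrAC lerDl mulrn_wge0// mulr_ge0.
Qed.

Lemma eucl_norm2_le_dist p q :
  eucl_norm2 (p.1.1 - q.1.1, p.1.2 - q.1.2) <= eucl_dist p q.
Proof. by rewrite /eucl_norm2/= ler_wsqrtr// lerDl sqr_ge0. Qed.

Lemma snd_le_dist p q : `|p.2 - q.2| <= eucl_dist p q.
Proof. by rewrite -sqrtr_sqr ler_wsqrtr// lerDr addr_ge0// sqr_ge0. Qed.

Lemma integrable_eucl_norm2 (D : set R) (u1 u2 : R -> R) : measurable D ->
  mu.-integrable D (EFin \o u1) -> mu.-integrable D (EFin \o u2) ->
  mu.-integrable D (EFin \o (fun s => eucl_norm2 (u1 s, u2 s))).
Proof.
move=> mD i1 i2.
have m1 : measurable_fun D u1 by have /integrableP[/measurable_EFinP] := i1.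
have m2 : measurable_fun D u2 by have /integrableP[/measurable_EFinP] := i2.
apply: (@le_integrable _ _ _ mu D mD _
  ((fun s => `|(u1 s)%:E| + `|(u2 s)%:E|)%E)).
- apply/measurable_EFinP; rewrite /eucl_norm2/=.
  apply: measurableT_comp.
    by apply: continuous_measurable_fun; exact: sqrt_continuous.
  by apply: measurable_funD; exact: measurable_funX.
- move=> s Ds; rewrite /= lee_fin.
  rewrite ger0_norm ?eucl_norm2_ge0// ger0_norm ?addr_ge0//.
  exact: (eucl_norm2_le_add (u1 s, u2 s)).
- by apply: integrableD => //; exact: integrable_abse.
Qed.

Lemma is_derive_fst (U V : normedModType R) (f : R -> U * V) s (w : U * V) :
  is_derive s 1 f w -> is_derive s 1 (fun x => (f x).1) w.1.
Proof.
move=> [df fE].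
have fl : h^-1 *: (f (h *: 1 + s) - f s) @[h --> 0^'] --> w.
  by rewrite -fE; exact: df.
have cvg1 : h^-1 *: ((f (h *: 1 + s)).1 - (f s).1) @[h --> 0^'] --> w.1.
  apply: (@cvg_comp _ _ _ _ fst _ _ _ fl); exact: cvg_fst.
apply: DeriveDef; first by apply/cvg_ex; exists w.1.
by apply: cvg_lim => //; exact: norm_hausdorff.
Qed.

Lemma is_derive_snd (U V : normedModType R) (f : R -> U * V) s (w : U * V) :
  is_derive s 1 f w -> is_derive s 1 (fun x => (f x).2) w.2.
Proof.
move=> [df fE].
have fl : h^-1 *: (f (h *: 1 + s) - f s) @[h --> 0^'] --> w.
  by rewrite -fE; exact: df.
have cvg1 : h^-1 *: ((f (h *: 1 + s)).2 - (f s).2) @[h --> 0^'] --> w.2.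
  apply: (@cvg_comp _ _ _ _ snd _ _ _ fl); exact: cvg_snd.
apply: DeriveDef; first by apply/cvg_ex; exists w.2.
by apply: cvg_lim => //; exact: norm_hausdorff.
Qed.

Lemma lipschitz_abs_continuousR a b gamma (f : R -> R) (K : R) : 0 < K ->
  (forall x y, `|f y - f x| <= K * eucl_dist (gamma y) (gamma x)) ->
  abs_continuous a b gamma -> abs_continuousR a b f.
Proof.
move=> K0 fK acg e e0.
have [|d d0 dP] := acg (e / K); first by rewrite divr_gt0.
exists d => // n B Bab tB sB; apply: le_lt_trans (ler_sum _ _) _.
  by move=> i _; exact: fK.
by rewrite -mulr_sumr mulrC -ltr_pdivlMr// dP.
Qed.

Lemma horizontal_subinterval a b c gamma (u1 u2 : R -> R) : c <= b ->
  horizontal a b gamma u1 u2 -> horizontal a c gamma u1 u2.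
Proof.
move=> cb [ac i1 i2 ae].
have sub : `[a, c]%classic `<=` `[a, b]%classic by exact: subset_itvl.
split; [|exact: integrableS i1|exact: integrableS i2|].
  move=> e /ac[d d0 dP]; exists d => // n B Bab; apply: dP => i.
  by have [? ? ?] := Bab i; split => //; exact: le_trans cb.
apply: filterS ae; first exact: (ae_filter_ringOfSetsType mu).
move=> s H /andP[as_ sc]; apply: H.
by rewrite as_ (lt_le_trans sc).
Qed.

(** The speed of the projection of the curve to a line spanned by v is
    u1 v1 + u2 v2, at most |(u1, u2)| by Cauchy-Schwarz. *)
Lemma horizontal_dir a b gamma (u1 u2 : R -> R) (v : R * R) : a < b ->
  horizontal a b gamma u1 u2 -> eucl_norm2 v <= 1 ->
  (v.1 * (gamma b).1.1 + v.2 * (gamma b).1.2) -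
  (v.1 * (gamma a).1.1 + v.2 * (gamma a).1.2) <= horizontal_length a b u1 u2.
Proof.
move=> ab [ac i1 i2 ae] v1.
apply: (@ac_increment_le_integral _ a b
   (fun s => v.1 * (gamma s).1.1 + v.2 * (gamma s).1.2)
   (fun s => eucl_norm2 (u1 s, u2 s)) (fun s => v.1 * u1 s + v.2 * u2 s)) => //.
- apply: (@lipschitz_abs_continuousR _ _ gamma _ 1) => // x y.
  have H (w : R * R) : eucl_norm2 w <= 1 ->
      w.1 * ((gamma y).1.1 - (gamma x).1.1) +
      w.2 * ((gamma y).1.2 - (gamma x).1.2)
      <= eucl_dist (gamma y) (gamma x).
    move=> w1; apply: le_trans (eucl_norm2_le_dist _ _).
    apply: le_trans (cauchy_schwarz2 w (_, _)) _.
    by rewrite ler_piMl// eucl_norm2_ge0.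
  rewrite mul1r ler_norml; apply/andP; split.
    have := H (- v.1, - v.2).
    rewrite /eucl_norm2/= !sqrrN => /(_ v1); lra.
  have := H v v1; lra.
- exact: integrable_eucl_norm2.
- by move=> s; exact: eucl_norm2_ge0.
apply: filterS ae; first exact: (ae_filter_ringOfSetsType mu).
move=> s H /H{}H; split.
  have H11 := is_derive_fst (is_derive_fst H).
  have H12 := is_derive_snd (is_derive_fst H).
  rewrite (_ : v.1 * u1 s + v.2 * u2 s =
    v.1 *: (u1 s *: fieldX (gamma s) + u2 s *: fieldY (gamma s)).1.1 +
    v.2 *: (u1 s *: fieldX (gamma s) + u2 s *: fieldY (gamma s)).1.2).
    exact: is_deriveD (is_deriveZ v.1 H11) (is_deriveZ v.2 H12).
  by rewrite /GRing.scale/= /GRing.scale/=; ring.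
rewrite (le_trans (cauchy_schwarz2 v (u1 s, u2 s)))// ler_piMl//.
exact: eucl_norm2_ge0.
Qed.

(** The radius at one end is attained by projecting to the direction of that
    end, where the other end projects to at most its own radius. *)
Lemma horizontal_norm_le a b gamma (u1 u2 : R -> R) : a < b ->
  horizontal a b gamma u1 u2 ->
  `|eucl_norm2 (gamma b).1 - eucl_norm2 (gamma a).1|
    <= horizontal_length a b u1 u2.
Proof.
move=> ab hg.
have L0 : 0 <= horizontal_length a b u1 u2.
  by apply: Rintegral_ge0 => s _; exact: eucl_norm2_ge0.
have unit (z : R * R) : exists2 v : R * R, eucl_norm2 v <= 1 &
    v.1 * z.1 + v.2 * z.2 = eucl_norm2 z.
  have [z0|z0] := eqVneq (eucl_norm2 z) 0.
    exists (0, 0); first by rewrite /eucl_norm2/= expr0n/= addr0 sqrtr0.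
    by rewrite z0/= !mul0r addr0.
  exists (z.1 / eucl_norm2 z, z.2 / eucl_norm2 z).
    rewrite -(@ler_pXn2r _ 2)// ?nnegrE ?eucl_norm2_ge0//.
    rewrite sqr_eucl_norm2/= expr1n !expr_div_n -mulrDl -sqr_eucl_norm2.
    by rewrite divff ?expf_neq0.
  by rewrite /= -[RHS](mulfK z0) -[in RHS]expr2 sqr_eucl_norm2; field.
rewrite ler_norml; apply/andP; split.
  have [v v1 vE] := unit (gamma a).1.
  have := @horizontal_dir a b gamma u1 u2 (- v.1, - v.2) ab hg.
  rewrite {1}/eucl_norm2/= !sqrrN => /(_ v1).
  have := cauchy_schwarz2 v (gamma b).1.
  have := ler_piMl (eucl_norm2_ge0 (gamma b).1) v1.
  lra.
have [v v1 vE] := unit (gamma b).1.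
have := @horizontal_dir a b gamma u1 u2 v ab hg v1.
have := cauchy_schwarz2 v (gamma a).1.
have := ler_piMl (eucl_norm2_ge0 (gamma a).1) v1.
lra.
Qed.

Lemma horizontal_length_le a b c (u1 u2 : R -> R) : c <= b ->
  mu.-integrable `[a, b] (EFin \o u1) -> mu.-integrable `[a, b] (EFin \o u2) ->
  horizontal_length a c u1 u2 <= horizontal_length a b u1 u2.
Proof.
move=> cb i1 i2; have i := integrable_eucl_norm2 (measurable_itv _) i1 i2.
have sub : `[a, c]%classic `<=` `[a, b]%classic by exact: subset_itvl.
rewrite /horizontal_length fine_le//.
- by apply: integrable_fin_num => //; exact: integrableS i.
- exact: integrable_fin_num.
- apply: ge0_subset_integral => //; first exact: (measurable_int mu).
  by move=> s _; rewrite lee_fin eucl_norm2_ge0.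
Qed.

(** Along the curve t' = 2 (y u1 - x u2), and the radius never exceeds the
    initial one plus the length already spent. *)
Lemma horizontal_snd_le a b gamma (u1 u2 : R -> R) : a < b ->
  horizontal a b gamma u1 u2 ->
  `|(gamma b).2 - (gamma a).2| <=
    2 * (eucl_norm2 (gamma a).1 + horizontal_length a b u1 u2)
    * horizontal_length a b u1 u2.
Proof.
move=> ab hg; set L := horizontal_length a b u1 u2.
have [ac i1 i2 ae] := hg.
have i := integrable_eucl_norm2 (measurable_itv `[a, b]) i1 i2.
have L0 : 0 <= L by apply: Rintegral_ge0 => s _; exact: eucl_norm2_ge0.
pose K := 2 * (eucl_norm2 (gamma a).1 + L).
have K0 : 0 <= K by rewrite mulr_ge0// addr_ge0// eucl_norm2_ge0.
have H (k : R) : `|k| = 1 -> k * (gamma b).2 - k * (gamma a).2 <= K * L.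
  move=> k1; rewrite /L /horizontal_length -RintegralZl//.
  apply: (@ac_increment_le_integral _ a b (fun s => k * (gamma s).2) _
    (fun s => k * (2 * ((gamma s).1.2 * u1 s - (gamma s).1.1 * u2 s)))) => //.
  - apply: (@lipschitz_abs_continuousR _ _ gamma _ 1) => // x y.
    by rewrite -mulrBr normrM k1 !mul1r snd_le_dist.
  - exact: (@integrableZl _ _ _ mu _ _ K _ i).
  - by move=> s; rewrite mulr_ge0// eucl_norm2_ge0.
  apply: filterS ae; first exact: (ae_filter_ringOfSetsType mu).
  move=> s D /[dup] sab /D{}D; split.
    rewrite (_ : k * (2 * ((gamma s).1.2 * u1 s - (gamma s).1.1 * u2 s)) =
      k *: (u1 s *: fieldX (gamma s) + u2 s *: fieldY (gamma s)).2).
      exact: (is_deriveZ k (is_derive_snd D)).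
    by rewrite /GRing.scale/= /GRing.scale/=; ring.
  apply: le_trans (ler_norm _) _; rewrite normrM k1 mul1r normrM ger0_norm//.
  rewrite /K -!mulrA ler_wpM2l//.
  have /andP[as_ sb] := sab.
  have := horizontal_norm_le as_ (horizontal_subinterval (ltW sb) hg).
  have := horizontal_length_le (ltW sb) i1 i2; rewrite -/L.
  move=> H1; rewrite ler_norml => /andP[_ H2].
  have {H1 H2}H : eucl_norm2 (gamma s).1 <= eucl_norm2 (gamma a).1 + L by lra.
  apply: le_trans (ler_wpM2r (eucl_norm2_ge0 (u1 s, u2 s)) H).
  have N1 : eucl_norm2 (- (gamma s).1.2, (gamma s).1.1) = eucl_norm2 (gamma s).1.
    by rewrite /eucl_norm2/= sqrrN addrC.
  have N2 : eucl_norm2 ((gamma s).1.2, - (gamma s).1.1) = eucl_norm2 (gamma s).1.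
    by rewrite /eucl_norm2/= sqrrN addrC.
  rewrite ler_norml; apply/andP; split.
    have := cauchy_schwarz2 (- (gamma s).1.2, (gamma s).1.1) (u1 s, u2 s).
    rewrite N1/=; lra.
  have := cauchy_schwarz2 ((gamma s).1.2, - (gamma s).1.1) (u1 s, u2 s).
  rewrite N2/=; lra.
rewrite ler_norml -/K; apply/andP; split.
  have := H (-1); rewrite normrN normr1 => /(_ erefl); lra.
have := H 1; rewrite normr1 => /(_ erefl); lra.
Qed.

End horizontal_curves.

(** * Polynomial horizontal curves and the Carnot-Caratheodory distance *)

Section polynomial_curves.
Context {R : realType}.
Notation mu := (@lebesgue_measure R).
Implicit Types (a b c s x y z r e : R) (p q : heis R) (px py pt : {poly R}).

Lemma poly_lipschitz (f : {poly R}) : exists2 K : R, 0 <= K &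
  forall x y, 0 <= x <= 1 -> 0 <= y <= 1 -> `|f.[y] - f.[x]| <= K * `|y - x|.
Proof.
(* The induction on the product with the variable also needs a bound M. *)
suff [M [K [M0 K0 _ H]]] : exists M K : R, [/\ 0 <= M, 0 <= K,
    forall x, 0 <= x <= 1 -> `|f.[x]| <= M &
    forall x y, 0 <= x <= 1 -> 0 <= y <= 1 -> `|f.[y] - f.[x]| <= K * `|y - x|].
  by exists K.
elim/poly_ind: f => [|f c [M [K [M0 K0 fM fK]]]].
  exists 0, 0; split => // [x _|x y _ _]; first by rewrite horner0 normr0.
  by rewrite !horner0 subrr normr0 mul0r.
exists (M + `|c|), (K + M); split; [by rewrite addr_ge0|by rewrite addr_ge0| |].
- move=> x /andP[x0 x1]; rewrite !hornerE (le_trans (ler_normD _ _))// lerD2r.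
  rewrite normrM (ger0_norm x0) -[M]mulr1 ler_pM//.
  by apply: fM; rewrite x0.
- move=> x y x01 y01; have /andP[y0 y1] := y01; rewrite !hornerE.
  rewrite (_ : _ - _ = (f.[y] - f.[x]) * y + f.[x] * (y - x)); last by ring.
  rewrite (le_trans (ler_normD _ _))// [leRHS]mulrDl lerD// normrM.
    by rewrite (ger0_norm y0) (le_trans (ler_piMr _ y1))// fK.
  by rewrite ler_wpM2r// fM.
Qed.

Lemma eucl_dist_le_add p q :
  eucl_dist p q <= `|p.1.1 - q.1.1| + `|p.1.2 - q.1.2| + `|p.2 - q.2|.
Proof.
rewrite -(@ler_pXn2r _ 2)// ?nnegrE ?addr_ge0 ?sqrtr_ge0//.
rewrite sqr_sqrtr ?addr_ge0 ?sqr_ge0//.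
rewrite -(real_normK (num_real (p.1.1 - _))) -(real_normK (num_real (p.1.2 - _))).
rewrite -(real_normK (num_real (p.2 - _))).
move: (normr_ge0 (p.1.1 - q.1.1)) (normr_ge0 (p.1.2 - q.1.2)) (normr_ge0 (p.2 - q.2)).
nra.
Qed.

Lemma is_derive_pair (U V : normedModType R) (f : R -> U) (g : R -> V) s
    (v : U) (w : V) :
  is_derive s 1 f v -> is_derive s 1 g w ->
  is_derive s 1 (fun x => (f x, g x)) (v, w).
Proof.
move=> [df fE] [dg gE].
have fl : h^-1 *: (f (h *: 1 + s) - f s) @[h --> 0^'] --> v.
  by rewrite -fE; exact: df.
have gl : h^-1 *: (g (h *: 1 + s) - g s) @[h --> 0^'] --> w.
  by rewrite -gE; exact: dg.
have cvg1 := cvg_pair fl gl.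
apply: DeriveDef; first by apply/cvg_ex; exists (v, w); exact: cvg1.
apply: cvg_lim; last exact: cvg1.
exact: (@norm_hausdorff _ (U * V)%type).
Qed.

Lemma is_derive_horner (f : {poly R}) s : is_derive s 1 (horner f) f^`().[s].
Proof.
rewrite derive.derivE derive1E; apply: derivableP; exact: derivable_horner.
Qed.

Definition poly_curve px py pt s : heis R := (px.[s], py.[s], pt.[s]).

Lemma horizontal_vectorE (u v : R) p :
  u *: fieldX p + v *: fieldY p = (u, v, 2 * (p.1.2 * u - p.1.1 * v)).
Proof.
congr (_, _, _) => /=; rewrite /GRing.scale/= /GRing.scale/=; ring.
Qed.

Lemma horizontal_poly_curve px py pt :
  pt^`() = 2 * (py * px^`() - px * py^`()) ->
  horizontal 0 1 (poly_curve px py pt) (horner px^`()) (horner py^`()).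
Proof.
move=> ptE.
have int (f : {poly R}) : mu.-integrable `[0, 1] (EFin \o horner f).
  apply: continuous_compact_integrable; first exact: segment_compact.
  by apply: continuous_subspaceT; exact: continuous_horner.
split => //.
  move=> e e0.
  have [Kx Kx0 xK] := poly_lipschitz px.
  have [Ky Ky0 yK] := poly_lipschitz py.
  have [Kt Kt0 tK] := poly_lipschitz pt.
  have K0 : 0 < Kx + Ky + Kt + 1 by lra.
  exists (e / (Kx + Ky + Kt + 1)); first by rewrite divr_gt0.
  move=> n B B01 _; rewrite ltr_pdivlMr// => /(le_lt_trans _); apply.
  rewrite mulr_suml; apply: ler_sum => i _.
  have [B0 BB B1] := B01 i.
  have i1 : 0 <= (B i).1 <= 1 by rewrite B0 (le_trans BB).
  have i2 : 0 <= (B i).2 <= 1 by rewrite B1 (le_trans B0).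
  apply: le_trans (eucl_dist_le_add _ _) _.
  have := xK _ _ i1 i2; have := yK _ _ i1 i2; have := tK _ _ i1 i2.
  rewrite (@ger0_norm _ ((B i).2 - (B i).1)) ?subr_ge0//= => H1 H2 H3.
  have : 0 <= (B i).2 - (B i).1 by rewrite subr_ge0.
  lra.
apply: aeW => s _.
rewrite (_ : _ + _ = (px^`().[s], py^`().[s], pt^`().[s])).
  exact: (is_derive_pair (is_derive_pair (is_derive_horner px s)
    (is_derive_horner py s)) (is_derive_horner pt s)).
by rewrite ptE !hornerE horizontal_vectorE.
Qed.

Lemma cc_lengths_lb p q : has_lbound [set L : R |
  exists a b gamma (u1 u2 : R -> R),
    [/\ a < b, gamma a = p, gamma b = q, horizontal a b gamma u1 u2
      & L = horizontal_length a b u1 u2]].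
Proof.
exists 0 => L [a [b [gamma [u1 [u2 [_ _ _ _ ->]]]]]].
by apply: Rintegral_ge0 => s _; exact: eucl_norm2_ge0.
Qed.

(** The straight line from (x0, y0) to (x1, y1) is perturbed by loops phi in x
    and 35 b psi in y.  Both loops have mean zero, so the area swept
    bilinearly between line and loops integrates to 0, and t is corrected by a
    nonzero multiple of b alone: the integral of psi phi' - phi psi' over
    [0, 1] is -1/35.  The polynomials Psi and Theta are the antiderivatives of
    2 psi and of 35 (psi phi' - phi psi') that vanish at 0. *)
Lemma joining_curve p q : exists gamma (u1 u2 : R -> R),
  [/\ gamma 0 = p, gamma 1 = q & horizontal 0 1 gamma u1 u2].
Proof.
case: p q => [[x0 y0] t0] [[x1 y1] t1].
pose A := x1 - x0; pose B := y1 - y0; pose b := (t0 - t1) / 2 + (y0 * A - x0 * B).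
pose w : {poly R} := 'X - 'X ^+ 2.
pose phi : {poly R} := w * (1%:P - 2%:P * 'X).
pose psi : {poly R} := 5%:P * w ^+ 2 - w.
pose Psi : {poly R} :=
  4%:P * 'X ^+ 3 - 5%:P * 'X ^+ 4 + 2%:P * 'X ^+ 5 - 'X ^+ 2.
pose Theta : {poly R} := - (35%:P * 'X ^+ 3) + 140%:P * 'X ^+ 4
  - 231%:P * 'X ^+ 5 + 175%:P * 'X ^+ 6 - 50%:P * 'X ^+ 7.
pose px := x0%:P + A%:P * 'X + phi.
pose py := y0%:P + B%:P * 'X + (35 * b)%:P * psi.
pose pt := t0%:P + 2%:P * ((y0 * A - x0 * B)%:P * 'X + y0%:P * phi
   - (35 * b * x0)%:P * psi + B%:P * ('X * phi - w ^+ 2)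
   + (35 * b * A)%:P * (Psi - 'X * psi) + b%:P * Theta).
have ptE : pt^`() = 2 * (py * px^`() - px * py^`()).
  have dE := (derivD, derivN, derivM, derivC, derivXn, derivX).
  have w' : w^`() = 1 - 2 * 'X by rewrite /w !dE/=; ring.
  have phi' : phi^`() = (1 - 2 * 'X) ^+ 2 - 2 * w.
    rewrite /phi derivM w' !dE/=; ring.
  have psi' : psi^`() = (10 * w - 1) * (1 - 2 * 'X).
    by rewrite /psi derivD derivN derivM expr2 derivM w' derivC; ring.
  have Psi' : Psi^`() = 2 * psi.
    by rewrite /Psi /psi /w; rewrite !dE/=; ring.
  have Theta' : Theta^`() = 35 * (psi * phi^`() - phi * psi^`()).
    rewrite phi' psi' /Theta /phi /psi /w !dE/=; ring.
  have dw2 : (w ^+ 2)^`() = 2 * phi by rewrite expr2 derivM w' /phi; ring.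
  (* From here on only the derivatives just computed matter; the bodies are
     cleared because rewriting would unfold them. *)
  rewrite /pt /py /px; clearbody w phi psi Psi Theta A B b.
  rewrite !(dw2, Psi', Theta', dE).
  ring.
have hE := (hornerD, hornerN, hornerM, hornerC, hornerXn, hornerX, horner_exp).
have ends : [/\ w.[0] = 0, phi.[0] = 0, psi.[0] = 0, Psi.[0] = 0 & Theta.[0] = 0]
    /\ [/\ w.[1] = 0, phi.[1] = 0, psi.[1] = 0, Psi.[1] = 0 & Theta.[1] = -1].
  by split; split; rewrite /Theta /Psi /psi /phi /w !hE; ring.
exists (poly_curve px py pt), (horner px^`()), (horner py^`()).
move: ptE ends; rewrite /poly_curve /pt /py /px.
clearbody w phi psi Psi Theta; clear px py pt.
move=> ptE [[w0 f0 p0 P0 T0] [w1 f1 p1 P1 T1]]; split.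
- by rewrite !hE w0 f0 p0 P0 T0; congr (_, _, _); ring.
- by rewrite !hE w1 f1 p1 P1 T1; congr (_, _, _); rewrite /b /A /B; field.
- exact: horizontal_poly_curve.
Qed.

Lemma cc_dist_ge0 p q : 0 <= cc_dist p q.
Proof.
apply: lb_le_inf.
  have [g [u1 [u2 [g0 g1 hg]]]] := joining_curve p q.
  by exists (horizontal_length 0 1 u1 u2), 0, 1, g, u1, u2.
move=> L [a [b [gamma [u1 [u2 [_ _ _ _ ->]]]]]].
by apply: Rintegral_ge0 => s _; exact: eucl_norm2_ge0.
Qed.

(** A distance less than r is witnessed by a curve shorter than r, to which the
    length bounds apply; the set of lengths has to be nonempty for that. *)
Lemma cc_dist_lt p q r : cc_dist p q < r ->
  `|eucl_norm2 q.1 - eucl_norm2 p.1| < r /\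
  `|q.2 - p.2| <= 2 * (eucl_norm2 p.1 + r) * r.
Proof.
move=> /inf_lt[|L [a [b [gamma [u1 [u2 [ab ga gb hg ->]]]]]] Lr].
  have [g [u1 [u2 [g0 g1 hg]]]] := joining_curve p q.
  by exists (horizontal_length 0 1 u1 u2), 0, 1, g, u1, u2.
have L0 : 0 <= horizontal_length a b u1 u2.
  by apply: Rintegral_ge0 => s _; exact: eucl_norm2_ge0.
have := horizontal_norm_le ab hg; have := horizontal_snd_le ab hg.
rewrite ga gb => H1 H2; split; first exact: le_lt_trans Lr.
apply: le_trans H1 _; have := eucl_norm2_ge0 p.1; nra.
Qed.

Lemma eucl_norm2_scale (c x y : R) :
  eucl_norm2 (c * x, c * y) = `|c| * eucl_norm2 (x, y).
Proof.
by rewrite /eucl_norm2/= !exprMn -mulrDr sqrtrM ?sqr_ge0// sqrtr_sqr.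
Qed.

(** The segment itself is horizontal, because (x, y) and its velocity are
    parallel. *)
Lemma cc_dist_radial (x y t c d : R) :
  cc_dist (c * x, c * y, t) (d * x, d * y, t) <= `|d - c| * eucl_norm2 (x, y).
Proof.
apply: ge_inf; first exact: cc_lengths_lb.
pose l z : {poly R} := (c * z)%:P + ((d - c) * z)%:P * 'X.
exists 0, 1, (poly_curve (l x) (l y) t%:P),
  (horner (l x)^`()), (horner (l y)^`()).
split => //.
- by rewrite /poly_curve /l !hornerE.
- by rewrite /poly_curve /l !hornerE; congr (_, _, _); ring.
- apply: horizontal_poly_curve.
  rewrite /l !(rmorphB, rmorphM, rmorphD)/= !(poly.derivE, derivM)/=; ring.
rewrite /horizontal_length.
have dl z s : (l z)^`().[s] = (d - c) * z.
  by rewrite /l !(poly.derivE, derivM)/= !hornerE.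
under eq_Rintegral do rewrite !dl.
rewrite Rintegral_cst//= lebesgue_measure_itv/= lte_fin ltr01/= oppr0 addr0 mulr1.
by rewrite eucl_norm2_scale.
Qed.

End polynomial_curves.

(** * Gaps of the Cantor set and of the set of radii *)

Section cantor_gaps.
Context {R : realType}.
Implicit Types (c x y z r e h l : R) (m n k : nat).

Lemma cantor_stage01 m x : cantor_stage m x -> 0 <= x <= 1.
Proof.
elim: m x => [|m IH] x /=; first by rewrite in_itv.
by case=> -[s /IH/andP[s0 s1] <-]; apply/andP; split; lra.
Qed.

Lemma cantor_stage0 m : cantor_stage m (0 : R).
Proof.
elim: m => [|m IH] /=; first by rewrite in_itv/= lexx ler01.
by left; exists 0 => //; rewrite mulr0 addr0.
Qed.

(** The interval of stage m that contains c loses its middle third, of centre z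
    and half-width h, at the next stage.  By self-similarity it is the image
    of the first middle third under m successive contractions; the bounds on
    z keep this image clear of the other half of the construction. *)
Lemma cantor_gap m c : cantor_stage m c ->
  exists z, let h := 3 ^- m / 6 in
  [/\ `|c - z| <= 3 ^- m, 0 <= z - h, z + h <= 1 &
      forall y, `|y - z| < h -> ~ cantor_stage m.+1 y].
Proof.
elim: m c => [|m IH] c.
  move=> /cantor_stage01/andP[c0 c1]; exists (1 / 2) => h.
  have hE : h = 1 / 6 by rewrite /h expr0 invr1.
  split; [|lra|lra|].
    by rewrite expr0 invr1 ler_norml; apply/andP; split; lra.
  move=> y; rewrite hE ltr_norml => /andP[y1 y2] /=.
  by case=> -[s /(@cantor_stage01 0)/andP[s0 s1] sy]; lra.
have E3 : 3 ^- m.+1 = 3 ^- m / 3 :> R by rewrite exprS invfM mulrC.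
rewrite E3; case=> -[s /IH[z [sz z0 z1 zP]] <-].
- exists (0 + 3^-1 * z) => h; split.
  + rewrite (_ : _ - _ = (s - z) / 3); last by field.
    by rewrite normrM [X in _ * X]ger0_norm ?invr_ge0// ler_wpM2r ?invr_ge0.
  + rewrite /h; lra.
  + rewrite /h; lra.
  + move=> y; rewrite /h ltr_norml => /andP[y1 y2] [] [t tS ty].
      apply: (zP t) tS; rewrite ltr_norml; apply/andP; split; lra.
    by move/(@cantor_stage01 m.+1) : tS => /andP[t0 t1]; lra.
- exists (2 / 3 + 3^-1 * z) => h; split.
  + rewrite (_ : _ - _ = (s - z) / 3); last by field.
    by rewrite normrM [X in _ * X]ger0_norm ?invr_ge0// ler_wpM2r ?invr_ge0.
  + rewrite /h; lra.
  + rewrite /h; lra.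
  + move=> y; rewrite /h ltr_norml => /andP[y1 y2] [] [t tS ty].
      by move/(@cantor_stage01 m.+1) : tS => /andP[t0 t1]; lra.
    apply: (zP t) tS; rewrite ltr_norml; apply/andP; split; lra.
Qed.

End cantor_gaps.

Section radii.
Context {R : realType}.
Implicit Types (c x y z r s e h l : R) (m n k : nat) (p : heis R).

Definition radii : set R :=
  \bigcup_(n in [set n : nat | (1 <= n)%N])
    \bigcup_(k in [set k : nat | (k <= 2 ^ n - 1)%N]) A_ n k.

Lemma PcE p : Pc p <-> 2 * eucl_norm2 p.1 ^+ 2 <= `|p.2| /\
  (p = 0 \/ radii (eucl_norm2 p.1)).
Proof. by []. Qed.

Lemma halfpow_gt0 n : 0 < (2 : R) ^- n.
Proof. by rewrite invr_gt0 exprn_gt0. Qed.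

Lemma quarterpowE n : (2 : R) ^- (2 * n) = 2 ^- n * 2 ^- n.
Proof. by rewrite mul2n -addnn exprD invfM. Qed.

Lemma A_itv n k s : A_ n k s ->
  2 ^- n + k%:R * 2 ^- (2 * n) <= s <= 2 ^- n + k.+1%:R * 2 ^- (2 * n).
Proof.
move=> [c /(_ 0%N I)/cantor_stage01/andP[c0 c1] <-].
have q := halfpow_gt0 (2 * n); rewrite lerDl mulr_ge0 ?(ltW q)//=.
by rewrite -addrA lerD2l -[k.+1%:R]natr1 mulrDl lerD2l mul1r ler_piMr// ltW.
Qed.

Lemma A_dyadic n k : (k <= 2 ^ n - 1)%N ->
  2 ^- n + k.+1%:R * 2 ^- (2 * n) <= 2 * 2 ^- n :> R.
Proof.
move=> kn; have q := halfpow_gt0 n.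
have n0 : (0 < 2 ^ n)%N by rewrite expn_gt0.
have : (k.+1 <= 2 ^ n)%N by rewrite -(ltn_predK n0) ltnS -subn1.
rewrite -(ler_nat R) natrX => k2.
rewrite quarterpowE mulrA (_ : 2 * _ = 2 ^- n + 2 ^+ n * 2 ^- n * 2 ^- n); last first.
  by rewrite divff ?expf_neq0//; ring.
by rewrite lerD2l ler_wpM2r ?(ltW q)// ler_wpM2r// ltW.
Qed.

(** The dyadic scale is recovered from strict inequalities up to a factor 2,
    which is how far apart the ends of a block of intervals are. *)
Lemma halfpow_lt_le n m : (2 : R) ^- n < 2 * 2 ^- m -> (m <= n)%N.
Proof.
rewrite leqNgt => H; apply/negP => nm; move: H; rewrite ltNge => /negP; apply.
rewrite -(subnK nm) addnS exprS exprD invfM mulrA divff// mul1r invfM.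
rewrite ler_piMl ?(ltW (halfpow_gt0 _))// invf_le1 ?exprn_gt0//.
by rewrite exprn_ege1// ler1n.
Qed.

(** The intervals carrying the Cantor sets have pairwise disjoint interiors, so
    inside one of them the only admissible radii are those of its own set. *)
Lemma radii_open_itv n k s : (k <= 2 ^ n - 1)%N ->
  2 ^- n + k%:R * 2 ^- (2 * n) < s < 2 ^- n + k.+1%:R * 2 ^- (2 * n) ->
  radii s -> A_ n k s.
Proof.
move=> kn /andP[s1 s2] [n' /= n1 [k' /= kn' As]].
have /andP[s3 s4] := A_itv As.
have q0 (j : nat) : 0 <= (j%:R : R) by [].
have nn : n' = n.
  apply/eqP; rewrite eqn_leq; apply/andP; split; apply: halfpow_lt_le.
    have := A_dyadic kn'; have := mulr_ge0 (q0 k) (ltW (halfpow_gt0 (2 * n))).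
    lra.
  have := A_dyadic kn; have := mulr_ge0 (q0 k') (ltW (halfpow_gt0 (2 * n'))).
  lra.
move: nn s3 s4 As kn' => -> s3 s4 As _.
suff -> : k = k' by [].
have q := halfpow_gt0 (2 * n).
have : (k%:R : R) < k'.+1%:R by rewrite -(ltr_pM2r q); lra.
have : (k'%:R : R) < k.+1%:R by rewrite -(ltr_pM2r q); lra.
by rewrite !ltr_nat !ltnS => a b; apply/eqP; rewrite eqn_leq a b.
Qed.

Lemma radii_gt0 r : radii r -> 0 < r.
Proof.
move=> [n _ [k _ /A_itv/andP[+ _]]]; apply: lt_le_trans.
by rewrite ltr_pwDl ?halfpow_gt0// mulr_ge0// ltW// halfpow_gt0.
Qed.

(** The gaps of the Cantor set A_ n k that contains r stay inside an interval
    which no other A_ n' k' enters, so they are gaps of the whole set.  The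
    ratio 6 between distance and half-width gives the porosity constant. *)
Lemma radii_gap r : radii r -> exists2 q : R, 0 < q & forall m, exists z,
  let h := q * 3 ^- m in
  [/\ `|r - z| <= 6 * h, 0 < h, h < z & forall s, `|s - z| < h -> ~ radii s].
Proof.
move=> [n n1 [k kn [c cC <-]]].
have Q := halfpow_gt0 (2 * n); set q := 2 ^- (2 * n) in Q *.
exists (q / 6) => [|m]; first by rewrite divr_gt0.
have [z [cz z0 z1 zP]] := cantor_gap (cC m I).
have t0 : 0 < (3 : R) ^- m by rewrite invr_gt0 exprn_gt0.
have kq : 0 <= k%:R * q by rewrite mulr_ge0// ltW.
exists (2 ^- n + k%:R * q + q * z) => h.
have hE : h = q * (3 ^- m / 6) by rewrite /h; field; rewrite expf_neq0.
split.
- rewrite (_ : _ - _ = q * (c - z)); last by ring.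
  by rewrite normrM gtr0_norm// hE
    (_ : 6 * _ = q * 3 ^- m) ?ler_pM2l//; field; rewrite expf_neq0.
- by rewrite hE mulr_gt0// divr_gt0.
- have := halfpow_gt0 n.
  have : h <= q * z by rewrite hE ler_pM2l//; lra.
  lra.
move=> s sz rs.
have qh : q * (z - 3 ^- m / 6) >= 0 by rewrite mulr_ge0// ltW.
have q1 : q * (z + 3 ^- m / 6) <= q * 1 by rewrite ler_pM2l.
have /andP[sz1 sz2] : - h < s - (2 ^- n + k%:R * q + q * z) < h by rewrite -ltr_norml.
have /(radii_open_itv kn) : 2 ^- n + k%:R * q < s < 2 ^- n + k.+1%:R * q.
  by rewrite -[k.+1%:R]natr1; apply/andP; split; rewrite hE in sz1 sz2; lra.
move=> /(_ rs) [d dC ds].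
apply: (zP d _ (dC m.+1 I)).
rewrite -(ltr_pM2l Q) -{1}(gtr0_norm Q) -normrM -hE; apply: le_lt_trans sz.
rewrite -ds -/q.
by rewrite (_ : q * (d - z) = 2 ^- n + k%:R * q + q * d -
    (2 ^- n + k%:R * q + q * z)) //; ring.
Qed.

Lemma A_left n k : A_ n k (2 ^- n + k%:R * 2 ^- (2 * n) : R).
Proof.
exists 0; last by rewrite mulr0 addr0.
by move=> m _; exact: cantor_stage0.
Qed.

End radii.

(** * Porosity of the set for the two distances *)

Section porosity_of_Pc.
Context {R : realType}.
Implicit Types (x y z t r s e l : R) (n k : nat) (p q a : heis R).

Lemma cvg0_geometric (q C : R) (u : nat -> R) : 0 <= q < 1 ->
  (forall j, 0 <= u j <= C * q ^+ j) -> u j @[j --> \oo] --> (0 : R).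
Proof.
move=> /andP[q0 q1] u01; apply: (@squeeze_cvgr _ _ _ _ (cst 0) (fun j => C * q ^+ j)).
- by apply: nearW => j; exact: u01.
- exact: cvg_cst.
- rewrite -[X in _ --> X](mulr0 C); apply: cvgMl_tmp.
  by apply: cvg_expr; rewrite ger0_norm.
Qed.

(** The holes are centred at the points obtained from a by moving radially to
    the centres of gaps of the set of radii. *)
Lemma porous_cc_radii a : radii (eucl_norm2 a.1) ->
  porous_with (@cc_dist R) (@Pc R) (1 / 6) a.
Proof.
case: a => [[x y] t] ar; set r := eucl_norm2 _ in ar *; have r0 := radii_gt0 ar.
have [q q0 /choice[z zP]] := radii_gap ar.
pose h j := q * 3 ^- j.
pose X j : heis R := (z j / r * x, z j / r * y, t).
have r0' : r != 0 by rewrite gt_eqF.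
have z0 j : 0 < z j by have [_ h0 hz _] := zP j; exact: lt_trans hz.
have Xr j : eucl_norm2 (X j).1 = z j.
  by rewrite eucl_norm2_scale -/r ger0_norm ?divr_ge0 ?ltW// divfK.
have Xd j : cc_dist (X j) (x, y, t) <= 6 * h j.
  have := cc_dist_radial x y t (z j / r) 1; rewrite !mul1r => /le_trans; apply.
  rewrite -/r -[X in _ * X](gtr0_norm r0) -normrM mulrBl mul1r divfK//.
  by have [] := zP j.
exists X; split.
- move=> j Xj; have [_ h0 _ /(_ r)] := zP j; apply => //.
  by rewrite -(Xr j) Xj subrr normr0.
- apply: (@cvg0_geometric 3^-1 (6 * q)).
    by rewrite invr_ge0 invf_lt1// ler0n ltr1n.
  by move=> j; rewrite cc_dist_ge0/= exprVn -mulrA.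
- move=> j; apply/seteqP; split => // p [pX /PcE[_ pP]].
  have : cc_dist (X j) p < h j by apply: lt_le_trans pX _; have := Xd j; lra.
  move=> /cc_dist_lt[]; rewrite Xr => pz _.
  have [_ h0 hz zgap] := zP j.
  case: pP => [p0|]; last exact: zgap.
  move: pz; rewrite p0 /eucl_norm2/= expr0n/= addr0 sqrtr0 sub0r normrN.
  by rewrite gtr0_norm// ltNge (ltW hz).
Qed.

(** On the ball of radius d / 6 around (d, 0, 0) the radius exceeds 5 d / 6,
    while |t| <= 2 (d + d / 6) (d / 6) = 14 d^2 / 36, less than 2 (5 d / 6)^2. *)
Lemma porous_cc_origin : porous_with (@cc_dist R) (@Pc R) (1 / 6) (0 : heis R).
Proof.
pose X j : heis R := (2 ^- j, 0, 0).
have Xr j : eucl_norm2 (X j).1 = 2 ^- j.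
  by rewrite /eucl_norm2/= expr0n/= addr0 sqrtr_sqr gtr0_norm// halfpow_gt0.
have Xd j : cc_dist (X j) 0 <= 2 ^- j.
  have := @cc_dist_radial R (2 ^- j) 0 0 1 0; rewrite !mul1r !mul0r.
  by rewrite sub0r normrN normr1 mul1r (_ : eucl_norm2 _ = 2 ^- j) //; exact: Xr.
exists X; split.
- by move=> j [/eqP]; rewrite gt_eqF// halfpow_gt0.
- apply: (@cvg0_geometric 2^-1 1).
    by rewrite invr_ge0 invf_lt1// ler0n ltr1n.
  by move=> j; rewrite cc_dist_ge0/= exprVn mul1r.
- move=> j; apply/seteqP; split => // p [pX /PcE[pU _]].
  have d0 := halfpow_gt0 (R := R) j.
  have : cc_dist (X j) p < 2 ^- j / 6.
    by apply: lt_le_trans pX _; have := Xd j; lra.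
  move=> /cc_dist_lt[]; rewrite Xr subr0 ltr_norml => /andP[N1 N2] T.
  have N0 := eucl_norm2_ge0 p.1.
  nra.
Qed.

Lemma porous_cc : porous (@cc_dist R) (@Pc R).
Proof.
exists (1 / 6); first by apply/andP; split; lra.
by move=> a /PcE[_ [->|/porous_cc_radii//]]; exact: porous_cc_origin.
Qed.

(** A point of the t-axis may be moved off the axis to any of the radii 2^-n,
    which get arbitrarily small. *)
Lemma Pc_dense_near_axis l t : 0 < l < 1 -> t != 0 ->
  exists2 q : heis R, Pc q & eucl_dist (0, 0, t) q < l * `|t|.
Proof.
move=> /andP[l0 l1] t0.
have lt0 : 0 < l * `|t| by rewrite mulr_gt0// normr_gt0.
have [n n1 nlt] : exists2 n, (1 <= n)%N & (2 : R) ^- n < l * `|t|.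
  have : 2^-1 ^+ n @[n --> \oo] --> (0 : R).
    by apply: cvg_expr; rewrite ger0_norm// invf_lt1// ltr1n.
  move=> /cvgr0_norm_lt /(_ _ lt0) [N _ NP].
  exists N.+1 => //; have := NP N.+1 (leqnSn N).
  by rewrite /= exprVn gtr0_norm// halfpow_gt0.
have d0 := halfpow_gt0 (R := R) n.
have N1 : eucl_norm2 (2 ^- n, 0 : R) = 2 ^- n.
  by rewrite /eucl_norm2/= expr0n/= addr0 sqrtr_sqr gtr0_norm.
exists (2 ^- n, 0, t); last first.
  by rewrite /eucl_dist/= !subrr sub0r sqrrN expr0n/= !addr0 sqrtr_sqr gtr0_norm.
apply/PcE; rewrite N1; split; last first.
  right; exists n => //; exists 0%N => //=.
  by have := A_left (R := R) n 0%N; rewrite mulr0n mul0r addr0.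
have : (2 : R) ^- n <= 2^-1.
  by rewrite -exprVn -[leRHS]expr1 ler_wiXn2l// ?invr_ge0// invf_le1// ler1n.
have : l * `|t| <= `|t| by rewrite ler_piMl// ltW.
nra.
Qed.

(** With d = 2^-n the power of 1/2 such that d <= r < 2 d, the left endpoints of
    the intervals A_ n k are d^2-spaced and belong to the set of radii. *)
Lemma radius_below r : 0 < r < 1 ->
  exists2 s, radii s & 0 < s <= r /\ r - s <= r ^+ 2.
Proof.
move=> /andP[r0 r1].
have ex : exists n, (2 : R) ^- n <= r.
  have : 2^-1 ^+ n @[n --> \oo] --> (0 : R).
    by apply: cvg_expr; rewrite ger0_norm// invf_lt1// ltr1n.
  move=> /cvgr0_norm_lt /(_ _ r0) [N _ NP].
  exists N; have := NP N (leqnn N).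
  by rewrite /= exprVn gtr0_norm ?halfpow_gt0// => /ltW.
case: (ex_minnP ex) => n nr nmin.
have n1 : (1 <= n)%N by case: n nr {nmin} => //; rewrite expr0 invr1 leNgt r1.
have rn : r < 2 * 2 ^- n.
  rewrite ltNge; apply/negP => H; suff : (n <= n.-1)%N.
    by rewrite leqNgt prednK// leqnn.
  apply: nmin; move: H.
  by rewrite -{1}(prednK n1) exprS invfM mulrA divff// mul1r.
set d := (2 : R) ^- n in nr rn *; have d0 : 0 < d by exact: halfpow_gt0.
pose k := Num.truncn ((r - d) / d ^+ 2).
have d20 : 0 < d ^+ 2 by rewrite exprn_gt0.
have /truncn_itv/andP[] : 0 <= (r - d) / d ^+ 2
  by apply: divr_ge0; [rewrite subr_ge0|exact: ltW].
rewrite -/k ler_pdivlMr// ltr_pdivrMr// => k1 k2.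
have qE : 2 ^- (2 * n) = d ^+ 2 by rewrite quarterpowE.
exists (d + k%:R * d ^+ 2).
  exists n => //; exists k => /=; last by rewrite -qE; exact: A_left.
  rewrite -ltnS subn1 prednK ?expn_gt0// -(ltr_nat R) natrX.
  rewrite -(ltr_pM2r d20) (le_lt_trans k1)//.
  rewrite expr2 mulrA /d divff ?expf_neq0// mul1r -/d; lra.
have kd : 0 <= k%:R * d ^+ 2 by rewrite mulr_ge0// ltW.
split; first by apply/andP; split; lra.
have : d ^+ 2 <= r ^+ 2 by rewrite ler_pXn2r// ?nnegrE ltW.
rewrite -natr1 in k2; lra.
Qed.

(** Off the axis, round the radius down to an admissible one and, if the point
    is outside Upsilon, push it vertically into Upsilon; both moves are of
    order r^2, in total at most 6 r^2, which is less than l r for r < l / 6. *)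
Lemma Pc_dense_near_origin l p : 0 < l < 1 -> p <> 0 ->
  eucl_dist p 0 < l / 6 ->
  exists2 q, Pc q & eucl_dist p q < l * eucl_dist p 0.
Proof.
case: p => [[x y] t] l01 p0 pl; have /andP[l0 l1] := l01.
set D := eucl_dist _ _ in pl *.
have xD : eucl_norm2 (x, y) <= D.
  by have := eucl_norm2_le_dist (x, y, t) 0; rewrite /= !subr0.
set r := eucl_norm2 (x, y) in xD *.
have := eucl_norm2_ge0 (x, y); rewrite -/r le_eqVlt => /predU1P[r0|r0].
  have := sqr_eucl_norm2 (x, y); rewrite -/r -r0 expr0n/= => /esym/eqP.
  rewrite paddr_eq0 ?sqr_ge0// !sqrf_eq0 => /andP[/eqP x0 /eqP y0].
  have t0 : t != 0 by apply/eqP => t0; apply: p0; rewrite x0 y0 t0.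
  have -> : D = `|t|.
    by rewrite /D /eucl_dist/= x0 y0 !subr0 expr0n/= !add0r sqrtr_sqr.
  by rewrite x0 y0; exact: Pc_dense_near_axis.
have [|s sr [/andP[s0 sler] rs]] := @radius_below r; first by rewrite r0; lra.
have r0' : r != 0 by rewrite gt_eqF.
have [t' t't tt'] : exists2 t', 2 * s ^+ 2 <= `|t'| & `|t - t'| < 4 * r ^+ 2.
  have s2 : s ^+ 2 <= r ^+ 2 by rewrite ler_pXn2r// ?nnegrE ltW.
  have r2 : 0 < r ^+ 2 by rewrite exprn_gt0.
  have [tr|tr] := leP (2 * r ^+ 2) `|t|.
    by exists t; [lra|rewrite subrr normr0; lra].
  exists (2 * r ^+ 2); first by rewrite ger0_norm; lra.
  move: tr; rewrite ltr_norml => /andP[tr1 tr2].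
  by rewrite ltr_norml; apply/andP; split; lra.
have sN : eucl_norm2 (s / r * x, s / r * y) = s.
  by rewrite eucl_norm2_scale -/r ger0_norm ?divr_ge0 ?ltW// divfK.
exists (s / r * x, s / r * y, t').
  by apply/PcE; rewrite sN; split => //; right.
have coord (z : R) : `|z| <= r -> `|z - s / r * z| <= r ^+ 2.
  move=> zr; rewrite (_ : z - _ = (r - s) * (z / r)); last by field.
  rewrite normrM (ger0_norm (_ : 0 <= r - s)) ?subr_ge0//.
  apply: le_trans rs; rewrite ler_piMr ?subr_ge0// normrM normfV (gtr0_norm r0).
  by rewrite ler_pdivrMr// mul1r.
apply: le_lt_trans (eucl_dist_le_add _ _) _ => /=.
have xr : `|x| <= r by rewrite -sqrtr_sqr ler_wsqrtr// lerDl sqr_ge0.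
have yr : `|y| <= r by rewrite -sqrtr_sqr ler_wsqrtr// lerDr sqr_ge0.
have := coord x xr; have := coord y yr.
have : 6 * r ^+ 2 <= l * D by nra.
lra.
Qed.

Lemma not_porous_eucl : ~ porous_at (@eucl_dist R) (@Pc R) (0 : heis R).
Proof.
move=> [l l01 [u [u0 ucvg ube]]].
have l6 : 0 < l / 6 by case/andP: l01 => ? _; rewrite divr_gt0.
move/cvgr0_norm_lt : ucvg => /(_ _ l6)[N _ NP].
have [|q qP uq] := @Pc_dense_near_origin l (u N) l01 (u0 N).
  by have := NP N (leqnn N); rewrite /= ger0_norm ?sqrtr_ge0.
have : (dball (@eucl_dist R) (u N) (l * eucl_dist (u N) 0) `&` (@Pc R)) q by split.
by rewrite ube.
Qed.

End porosity_of_Pc.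

Theorem proposition3p10 (R : realType) :
  porous (@cc_dist R) (@Pc R) /\
  ~ porous_at (@eucl_dist R) (@Pc R) (0%R : heis R).
Proof. by split; [exact: porous_cc | exact: not_porous_eucl]. Qed.
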